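(* Let $\ell,d,\rho$ be positive integers with $\ell\le m$, $d\le\ell(q-1)$ and $\rho\le|\mathbb{H}^{(\ell)}_{\le d}|$. Let $\mathcal{T}\subseteq\mathbb{H}^{(\ell)}_{\le d}$ with $|\mathcal{T}|=\rho$, and let $\rho'=|\mathcal{T}\cap\mathbb{H}^{(\ell)}_d|$. Then $$|\mathsf{FP}^{(\ell)}(\mathcal{T})|\le|\mathsf{FP}^{(\ell)}(\mathcal{U})|,\quad\text{where }\ \mathcal{U}=\mathcal{L}^{(\ell)}_d(\rho')\cup\mathcal{M}^{(\ell)}_{d-1}(\rho-\rho').$$
   Context: $q$ is a prime power and $m$ a positive integer. For $0\le\ell\le m$, $\mathbb{H}^{(\ell)}=\{x_0^{a_0}\cdots x_{\ell-1}^{a_{\ell-1}}:0\le a_j\le q-1\}$; $\mathbb{H}^{(\ell)}_d$ and $\mathbb{H}^{(\ell)}_{\le d}$ are its elements of degree $d$, resp. degree $\le d$. For $\mathcal{T}\subseteq\mathbb{H}^{(\ell)}$, the shadow is $\mathsf{SH}^{(\ell)}(\mathcal{T})=\{\mu\in\mathbb{H}^{(\ell)}:\nu\mid\mu\text{ for some }\nu\in\mathcal{T}\}$ and the footprint is $\mathsf{FP}^{(\ell)}(\mathcal{T})=\mathbb{H}^{(\ell)}\setminus\mathsf{SH}^{(\ell)}(\mathcal{T})$. Lexicographic order: $x_0^{b_0}\cdots\prec x_0^{a_0}\cdots$ iff at the first index where the exponents differ one has $a_i>b_i$. For $0\le\rho\le|\mathbb{H}^{(\ell)}_{\le d}|$,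 $\mathcal{M}^{(\ell)}_d(\rho)$ is the set of the first $\rho$ elements of $\mathbb{H}^{(\ell)}_{\le d}$ in descending lexicographic order; for $0\le\rho'\le|\mathbb{H}^{(\ell)}_d|$, $\mathcal{L}^{(\ell)}_d(\rho')$ is the set of the first $\rho'$ elements of $\mathbb{H}^{(\ell)}_d$ in descending lexicographic order. *)

(* Defs.v *)
From mathcomp Require Import all_boot.
Set Implicit Arguments. Unset Strict Implicit. Unset Printing Implicit Defensive.

(* A monomial x_0^{a_0} ... x_{l-1}^{a_{l-1}} with 0 <= a_j <= q-1 is
   represented by its exponent vector j |-> a_j : 'I_q. *)
Definition mon (l q : nat) := {ffun 'I_l -> 'I_q}.

Section Monomials.
Variables l q : nat.

Definition deg (mu : mon l q) : nat := \sum_(i < l) (mu i : nat).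

Definition Heq (d : nat) : {set mon l q} := [set mu : mon l q | deg mu == d].
Definition Hle (d : nat) : {set mon l q} := [set mu : mon l q | deg mu <= d].

Definition mdvd (nu mu : mon l q) : bool := [forall i, (nu i : nat) <= mu i].

Definition shadow (T : {set mon l q}) : {set mon l q} :=
  [set mu : mon l q | [exists nu in T, mdvd nu mu]].
Definition footprint (T : {set mon l q}) : {set mon l q} := ~: shadow T.

Definition lexlt (b a : mon l q) : bool :=
  [exists i : 'I_l, [forall j : 'I_l, (j < i) ==> (b j == a j)] && (b i < a i)].

(* The first rho elements of S in descending lexicographic order: those
   elements x of S with fewer than rho elements of S strictly lex-greater. *)
Definition firstlex (S : {set mon l q}) (rho : nat) : {set mon l q} :=
  [set x in S | #|[set y in S | lexlt x y]| < rho].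

Definition Mset (d rho : nat) := firstlex (Hle d) rho.
Definition Lset (d rho : nat) := firstlex (Heq d) rho.
End Monomials.

Definition prime_power (q : nat) : Prop := exists p k, prime p /\ 0 < k /\ q = p ^ k.

(* Main.v *)
Require Import Defs.
From mathcomp Require Import all_boot zify.
Set Implicit Arguments. Unset Strict Implicit. Unset Printing Implicit Defensive.

(** Write [S] for the shadow of [T] and replace [S], degree by degree, by the initial
    lexicographic segment of the same size; call the result [R].  By the Clements-Lindstrom
    theorem [R] is again closed under multiplication by variables.  If [x] has degree [d - 1] and
    is one of the first [rho - rho'] monomials of degree at most [d - 1], then [x] lies in [R]:
    otherwise, [R] being closed upwards, every element of [R] of degree at most [d - 1] is
    lexicographically greater than [x], and there are fewer than [rho - rho'] such monomials.  So
    in degrees at least [d] the shadow of [U] is contained in [R], while in degrees below [d] it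
    has at most [rho - rho'] elements, hence no more than [S].

    The Clements-Lindstrom theorem is proved by induction on the set [I] of variables allowed to
    vary.  For two variables it is an inspection of a chain.  With at least three variables, a set
    [A] that is compressed in every slice [x_j = c] is stable under replacing the last variable
    [x_k] of [I] by an earlier one, because some third variable stays fixed.  For such sets the
    upper shadow has as many elements as the upper shadow of the slice [x_k = 0] plus the part of
    [A] with [x_k < q - 1], and both terms are smallest for lexicographic segments. *)

(** * The lexicographic order *)

Section Lex.
Variables l q : nat.
Implicit Types (x y z u w : mon l q) (v : nat) (i j k : 'I_l) (S A B C T : {set mon l q}).

Lemma monP x y : (forall i, x i = y i :> nat) -> x = y.
Proof. by move=> e; apply/ffunP => i; apply/val_inj/e. Qed.

Lemma lexltP x y :
  reflect (exists2 i : 'I_l, forall j : 'I_l, j < i -> x j = y j & x i < y i) (lexlt x y).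
Proof.
apply: (iffP existsP) => [[i /andP[/forallP e lt]]|[i e lt]]; exists i => //.
  by move=> j ji; apply/eqP; move: (e j); rewrite ji.
by rewrite lt andbT; apply/forallP => j; apply/implyP => /e ->.
Qed.

Lemma lexlt_irr x : lexlt x x = false.
Proof. by apply/lexltP => -[i _]; rewrite ltnn. Qed.

Lemma lexlt_trans : transitive (@lexlt l q).
Proof.
move=> y x z /lexltP[i e1 l1] /lexltP[j e2 l2]; apply/lexltP.
case: (ltngtP i j) => [ij|ji|/val_inj ij].
- by exists i => [k ki|]; [rewrite e1 // e2 // (ltn_trans ki)|rewrite -e2].
- by exists j => [k kj|]; [rewrite e1 ?e2 // (ltn_trans kj)|rewrite e1].
- subst j; exists i => [k ki|]; [by rewrite e1 ?e2|exact: ltn_trans l2].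
Qed.

Lemma lexlt_total x y : [|| x == y, lexlt x y | lexlt y x].
Proof.
case: eqP => //= /eqP nxy.
have [i0 ni0] : exists i, x i != y i.
  apply/existsP; rewrite -negb_forall; apply: contra nxy => /forallP e.
  by apply/eqP/ffunP => i; apply/eqP.
case: (@arg_minnP _ i0 (fun i => x i != y i) (fun i => i : nat) ni0) => i ni mi.
have e (j : 'I_l) : j < i -> x j = y j.
  by move=> ji; apply/eqP; apply: contraLR ji => /mi; rewrite leqNgt.
move: ni; rewrite -(inj_eq val_inj) /= neq_ltn => /orP[lt|lt]; apply/orP.
  by left; apply/lexltP; exists i.
by right; apply/lexltP; exists i => // j /e.
Qed.

Definition lexle x y := (x == y) || lexlt x y.

Lemma lexltNge x y : lexlt x y = ~~ lexle y x.
Proof.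
rewrite /lexle negb_or; case: (eqVneq y x) => [->|n] /=; first exact: lexlt_irr.
have := lexlt_total x y; rewrite eq_sym (negPf n) /=.
case: (boolP (lexlt x y)) => [h _|_ /= ->//].
by apply/esym/negP => h'; move: (lexlt_trans h h'); rewrite lexlt_irr.
Qed.

(** An out-of-range [v] leaves the exponent unchanged, so [inc i] fixes a monomial whose exponent at
    [i] is q - 1; hence the guards [(x i).+1 < q] below. *)
Definition upd x i v : mon l q :=
  [ffun j => if j == i then insubd (x i) v else x j].
Definition inc i x := upd x i (x i).+1.
Definition dec i x := upd x i (x i).-1.

Lemma updE x i v j : v < q -> upd x i v j = (if j == i then v else x j) :> nat.
Proof. by move=> h; rewrite ffunE; case: eqP => // _; rewrite val_insubd h. Qed.

Lemma incE i x j : (x i).+1 < q -> inc i x j = (j == i) + x j :> nat.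
Proof. by move=> h; rewrite updE //; case: eqP => // ->. Qed.

Lemma decE i x j : dec i x j = x j - (j == i) :> nat.
Proof.
rewrite updE; first by case: eqP => [->|_]; rewrite ?subn1 ?subn0.
exact: leq_ltn_trans (leq_pred _) (ltn_ord _).
Qed.

Lemma upd_off x i v j : j != i -> upd x i v j = x j.
Proof. by rewrite ffunE => /negPf ->. Qed.

Lemma deg_upd x i v : v < q -> deg (upd x i v) + x i = deg x + v.
Proof.
move=> vq; rewrite /deg (bigD1 i) // [in RHS](bigD1 i) //= updE // eqxx.
rewrite (eq_bigr (fun j => x j : nat)); first lia.
by move=> j ji; rewrite upd_off.
Qed.

Lemma deg_inc i x : (x i).+1 < q -> deg (inc i x) = (deg x).+1.
Proof. by move=> h; have := @deg_upd x i _ h; rewrite /inc; lia. Qed.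

Lemma deg_dec i x : 0 < x i -> (deg (dec i x)).+1 = deg x.
Proof.
move=> h; have := @deg_upd x i (x i).-1; rewrite /dec.
have := ltn_ord (x i); lia.
Qed.

Lemma inc_dec i x : 0 < x i -> inc i (dec i x) = x.
Proof.
move=> h; have xq := ltn_ord (x i); apply: monP => j.
rewrite incE !decE ?eqxx; last lia.
by case: eqP => [->|]; lia.
Qed.

Lemma dec_inc i x : (x i).+1 < q -> dec i (inc i x) = x.
Proof. by move=> h; apply: monP => j; rewrite decE incE //; lia. Qed.

Lemma inc_gt i x : (x i).+1 < q -> lexlt x (inc i x).
Proof.
move=> h; apply/lexltP; exists i; last by rewrite incE // eqxx.
by move=> j ji; rewrite upd_off //; apply: contraTneq ji => ->; rewrite ltnn.
Qed.

Lemma deg_dom x y : (forall j, x j <= y j) -> deg y <= deg x -> x = y.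
Proof.
move=> h le.
have := @leqif_sum _ predT (fun j => x j == y j :> nat) (fun j => x j : nat)
  (fun j => y j : nat) (fun j _ => leqif_eq (h j)).
move=> [_ e]; apply: monP => j.
have : \sum_i (x i : nat) == \sum_i y i.
  by rewrite eqn_leq le andbT; apply: leq_sum.
by rewrite e => /forall_inP/(_ j isT)/eqP.
Qed.

Lemma lexle_dom x y : (forall j, x j <= y j) -> lexle x y.
Proof.
move=> h; have := lexlt_total x y; rewrite /lexle => /or3P[->//|->//|]; first by rewrite orbT.
by case/lexltP => i _; rewrite ltnNge h.
Qed.

Lemma ord_lt_eqF i j : i < j -> (i == j) = false.
Proof. by rewrite -(inj_eq val_inj); apply: ltn_eqF. Qed.

(** Let [p] be the first index where [x] and [u] differ. Raising a later variable does not disturb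
    the comparison at [p]. If all later exponents of [x] are already q - 1, raise [x p]: either it
    stays below [u p], or the result dominates [u] and the degrees force equality. *)
Lemma lex_inc_le x u : lexlt x u -> deg x < deg u ->
  exists2 i : 'I_l, (x i).+1 < q & lexle (inc i x) u.
Proof.
case/lexltP=> p e lt dlt; have uq := ltn_ord (u p).
have [/existsP[i /andP[pi iq]]|no] := boolP [exists i : 'I_l, (p < i) && ((x i).+1 < q)].
  exists i => //; apply/orP; right; apply/lexltP; exists p.
    by move=> j jp; rewrite upd_off ?e //; apply: contraTneq jp => ->; rewrite -leqNgt ltnW.
  by rewrite incE // ord_lt_eqF.
have xq : (x p).+1 < q by lia.
exists p => //; case: (ltnP (x p).+1 (u p)) => h.
  apply/orP; right; apply/lexltP; exists p; last by rewrite incE // eqxx.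
  by move=> j jp; rewrite upd_off ?e //; apply: contraTneq jp => ->; rewrite ltnn.
apply/orP; left; apply/eqP/esym/deg_dom; last by rewrite deg_inc.
move=> j; rewrite incE //; case: (ltngtP j p) => [/e ->|pj|/val_inj ->];
  [exact: leq_addl| |by rewrite eqxx].
have := ltn_ord (u j); move/existsPn/(_ j): no; rewrite pj /=; lia.
Qed.

(** Dual argument: lower a variable of [w] after the first difference [p], or [w p] itself when all
    later exponents of [w] in [I] vanish. In the tight case [u] dominates the result and the degrees
    force equality. *)
Lemma lex_dec_ge (I : {set 'I_l}) u w : (forall j, j \notin I -> u j = w j) ->
  lexlt u w -> deg u < deg w -> exists i, [/\ i \in I, 0 < w i & lexle u (dec i w)].
Proof.
move=> ag /lexltP[p e lt] dlt.
have pI : p \in I by apply: contraTT lt => /ag ->; rewrite ltnn.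
have [/existsP[i /and3P[iI pi iq]]|no] := boolP [exists i : 'I_l, [&& i \in I, p < i & 0 < w i]].
  exists i; split=> //; apply/orP; right; apply/lexltP; exists p.
    by move=> j jp; rewrite upd_off ?e //; apply: contraTneq jp => ->; rewrite -leqNgt ltnW.
  by rewrite decE ord_lt_eqF // subn0.
have w0 : 0 < w p by lia.
exists p; split=> //; case: (ltnP (u p).+1 (w p)) => h.
  apply/orP; right; apply/lexltP; exists p; last by rewrite decE eqxx; lia.
  by move=> j jp; rewrite upd_off ?e //; apply: contraTneq jp => ->; rewrite ltnn.
apply/orP; left; apply/eqP/esym/deg_dom; last by have := deg_dec w0; lia.
move=> j; rewrite decE //; case: (ltngtP j p) => [/e ->|pj|/val_inj ->];
  [exact: leq_subr| |by rewrite eqxx; lia].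
have [jI|/ag ->] := boolP (j \in I); last lia.
move/existsPn/(_ j): no; rewrite jI pj /=; lia.
Qed.

(** This is the step that brings the exponent at [k] down to that of [u] at constant degree. The
    case split is again on whether an index after the first difference [p], now also before [k], can
    be raised; in the tight case [u k < x k] still gives domination at [k]. *)
Lemma lex_swap_le (I : {set 'I_l}) k x u : (forall j, j \in I -> j <= k) ->
  (forall j, j \notin I -> x j = u j) -> lexlt x u -> deg x = deg u -> u k < x k ->
  exists i, [/\ i \in I, i < k, (x i).+1 < q & lexle (inc i (dec k x)) u].
Proof.
move=> km ag /lexltP[p e lt] dxu uk; have uq := ltn_ord (u p).
have pI : p \in I by apply: contraTT lt => /ag ->; rewrite ltnn.
have pk : p < k.
  rewrite ltn_neqAle km // andbT; apply: contraTneq lt => /val_inj ->.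
  by rewrite -leqNgt ltnW.
have decq (i : 'I_l) : i < k -> dec k x i = x i.
  by move=> ik; rewrite upd_off //; apply: contraTneq ik => ->; rewrite ltnn.
have x0 : 0 < x k by lia.
have [/existsP[i /and4P[iI pi ik iq]]|no] :=
  boolP [exists i : 'I_l, [&& i \in I, p < i, i < k & (x i).+1 < q]].
  exists i; split=> //; apply/orP; right; apply/lexltP; exists p.
    move=> j jp; rewrite upd_off; last by apply: contraTneq jp => ->; rewrite -leqNgt ltnW.
    by rewrite decq ?e // (ltn_trans jp).
  by rewrite incE ?decq // ord_lt_eqF.
have xq : (x p).+1 < q by lia.
exists p; split=> //; case: (ltnP (x p).+1 (u p)) => h.
  apply/orP; right; apply/lexltP; exists p; last by rewrite incE decq // eqxx.
  move=> j jp; rewrite upd_off; last by apply: contraTneq jp => ->; rewrite ltnn.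
  by rewrite decq ?e // (ltn_trans jp).
apply/orP; left; apply/eqP/esym/deg_dom; last first.
  by rewrite deg_inc ?decq // -dxu -(deg_dec x0).
move=> j; rewrite incE ?(decq p) // decE.
case: (ltngtP j p) => [jp|pj|/val_inj ->]; last by rewrite eqxx (ord_lt_eqF pk); lia.
  by rewrite (ord_lt_eqF jp) (ord_lt_eqF (ltn_trans jp pk)) subn0 e.
have [->|njk] := eqVneq j k; first lia.
have [jI|/ag ->] := boolP (j \in I); last lia.
have jk : j < k by rewrite ltn_neqAle km // andbT.
have := ltn_ord (u j); move/existsPn/(_ j): no; rewrite jI pj jk /=; lia.
Qed.

(** * Initial lexicographic segments *)

Definition initial S B := B \subset S /\ forall x y, x \in B -> y \in S -> lexlt x y -> y \in B.

Lemma initial_nested S B C : initial S B -> initial S C -> (B \subset C) || (C \subset B).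
Proof.
move=> [sB iB] [sC iC]; case: (boolP (B \subset C)) => //= /subsetPn[x xB xC].
apply/subsetP => y yC; apply: contraNT xC => yB.
have xS := subsetP sB _ xB; have yS := subsetP sC _ yC.
case/or3P: (lexlt_total x y) => [/eqP -> //|h|h]; last exact: iC h.
by rewrite (iB _ _ xB) in yB.
Qed.

Lemma initial_sub S B C : initial S B -> initial S C -> #|B| <= #|C| -> B \subset C.
Proof.
move=> iB iC le; case/orP: (initial_nested iB iC) => // CB.
suff /eqP -> : C == B by [].
by rewrite eqEcard CB.
Qed.

Lemma firstlex_initial S r : initial S (firstlex S r).
Proof.
split; first by apply/subsetP => x; rewrite inE => /andP[].
move=> x y; rewrite !inE => /andP[xS lt] yS xy; rewrite yS; apply: leq_ltn_trans lt.
apply/subset_leq_card/subsetP => w; rewrite !inE => /andP[-> /=].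
exact: lexlt_trans.
Qed.

(** The number of greater elements is injective on [S] with values below [#|S|], so it takes each of
    these values once, and [r] of them are below [r]. *)
Lemma card_firstlex S r : r <= #|S| -> #|firstlex S r| = r.
Proof.
move=> rS; pose rk x := #|[set y in S | lexlt x y]|.
have rk_lt x y : x \in S -> y \in S -> lexlt x y -> rk y < rk x.
  move=> xS yS xy; apply: proper_card; apply/properP; split.
    by apply/subsetP => w; rewrite !inE => /andP[-> /=]; apply: lexlt_trans.
  by exists y; rewrite !inE yS ?lexlt_irr.
have rk_inj : {in S &, injective rk}.
  move=> x y xS yS e; case/or3P: (lexlt_total x y) => [/eqP //|h|h].
    by move: (rk_lt _ _ xS yS h); rewrite e ltnn.
  by move: (rk_lt _ _ yS xS h); rewrite e ltnn.
have rk_S x : x \in S -> rk x < #|S|.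
  move=> xS; apply: proper_card; apply/properP; split.
    by apply/subsetP => w; rewrite inE => /andP[].
  by exists x; rewrite // inE lexlt_irr andbF.
pose s := map rk (enum S).
have us : uniq s by rewrite map_inj_in_uniq ?enum_uniq // => x y; rewrite !mem_enum; apply: rk_inj.
have ss : size s = #|S| by rewrite size_map cardE.
have ps : perm_eq s (iota 0 #|S|).
  apply: uniq_perm => //; first exact: iota_uniq.
  have sub : {subset s <= iota 0 #|S|}.
    by move=> m /mapP[y]; rewrite mem_enum mem_iota add0n => yS ->; apply: rk_S.
  by apply: (uniq_min_size us sub _).2; rewrite size_iota ss.
transitivity (count (fun m => m < r) s).
  rewrite count_map cardE -size_filter; apply/perm_size/uniq_perm.
  - exact: enum_uniq.
  - exact/filter_uniq/enum_uniq.
  - by move=> x; rewrite mem_enum inE mem_filter mem_enum andbC.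
rewrite (seq.permP ps) -{1}(subnKC rS) iotaD count_cat add0n.
rewrite (@eq_in_count _ _ predT) ?count_predT ?size_iota; last first.
  by move=> m; rewrite mem_iota.
rewrite (@eq_in_count _ _ pred0) ?count_pred0 ?addn0 // => m.
by rewrite mem_iota => /andP[rm _]; rewrite ltnNge rm.
Qed.
End Lex.

(** * Upper shadows in fibres and compression *)

Section Fibre.
Variables l q : nat.
Implicit Types (x y z u w : mon l q) (v c d : nat) (i j k : 'I_l).
Implicit Types (I J : {set 'I_l}) (S A B C T : {set mon l q}).

Definition fib I z d : {set mon l q} :=
  [set x | (deg x == d) && [forall j, (j \notin I) ==> (x j == z j)]].

Lemma fibP I z d x :
  reflect (deg x = d /\ forall j, j \notin I -> x j = z j) (x \in fib I z d).
Proof.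
rewrite inE; apply: (iffP andP) => [[/eqP e /forallP h]|[e h]]; split => //.
- by move=> j jI; apply/eqP; move: (h j); rewrite jI.
- exact/eqP.
- by apply/forallP => j; apply/implyP => /h ->.
Qed.

Lemma fibT z d : fib [set: 'I_l] z d = Heq l q d.
Proof.
apply/setP => x; apply/fibP/idP; rewrite inE; first by case=> ->.
by move/eqP; split=> // j; rewrite inE.
Qed.

Lemma fib_agree I z d d' x y : x \in fib I z d -> y \in fib I z d' ->
  forall j, j \notin I -> x j = y j.
Proof. by move=> /fibP[_ hx] /fibP[_ hy] j jI; rewrite hx ?hy. Qed.

Lemma fib_inc I z d i x : i \in I -> (x i).+1 < q ->
  (inc i x \in fib I z d.+1) = (x \in fib I z d).
Proof.
move=> iI iq; have off j : j \notin I -> inc i x j = x j.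
  by move=> jI; rewrite upd_off //; apply: contraNneq jI => ->.
apply/fibP/fibP; rewrite deg_inc // => -[h1 h2]; split; try lia.
  by move=> j jI; rewrite -h2 ?off.
by move=> j jI; rewrite off ?h2.
Qed.

Lemma fib_dec I z d i x : i \in I -> 0 < x i ->
  (dec i x \in fib I z d) = (x \in fib I z d.+1).
Proof.
by move=> iI i0; rewrite -{2}(inc_dec i0) fib_inc // decE eqxx; have := ltn_ord (x i); lia.
Qed.

Definition up I A : {set mon l q} :=
  [set y | [exists x in A, [exists i in I, ((x i).+1 < q) && (y == inc i x)]]].

Lemma upP I A y :
  reflect (exists x i, [/\ x \in A, i \in I, (x i).+1 < q & y = inc i x]) (y \in up I A).
Proof.
rewrite inE; apply: (iffP exists_inP).
  by case=> x xA /exists_inP[i iI /andP[iq /eqP ->]]; exists x, i.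
by case=> x [i [xA iI iq ->]]; exists x => //; apply/exists_inP; exists i; rewrite ?iq ?eqxx.
Qed.

Lemma up0 I : up I set0 = set0.
Proof. by apply/setP => y; rewrite in_set0; apply/upP => -[x [i []]]; rewrite inE. Qed.

Lemma up_mono I A B : A \subset B -> up I A \subset up I B.
Proof.
move=> /subsetP AB; apply/subsetP => y /upP[x [i [xA iI iq ->]]].
by apply/upP; exists x, i; rewrite AB.
Qed.

Lemma up_fib I z d A : A \subset fib I z d -> up I A \subset fib I z d.+1.
Proof.
by move=> /subsetP AF; apply/subsetP => y /upP[x [i [/AF xF iI iq ->]]]; rewrite fib_inc.
Qed.

(** If [w] lies above [inc i x], it lies above [x], and [lex_dec_ge] divides [w] by a variable of
    [I] without falling below [x]; the quotient is then in [B]. *)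
Lemma up_initial I z d B : initial (fib I z d) B -> initial (fib I z d.+1) (up I B).
Proof.
move=> [sB iB]; split; first exact: up_fib.
move=> y w /upP[x [i [xB iI iq ->]]] wF lt.
have xF := subsetP sB _ xB; have xw := lexlt_trans (inc_gt iq) lt.
have dlt : deg x < deg w by case/fibP: xF => ->; case/fibP: wF => ->.
have [j [jI w0 le]] := lex_dec_ge (fib_agree xF wF) xw dlt.
have wq := ltn_ord (w j).
apply/upP; exists (dec j w), j; split=> //; first 1 last.
- by rewrite decE eqxx; lia.
- by rewrite inc_dec.
case/orP: le => [/eqP <- //|]; apply: iB => //.
by rewrite fib_dec.
Qed.

(** * Slices of a fibre and compression in one direction *)

Definition slice j c A := [set x in A | x j == c :> nat].

Lemma card_slices j A : #|A| = \sum_(c < q) #|slice j c A|.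
Proof.
rewrite -sum1_card (partition_big (fun x => x j) predT) //=.
by apply: eq_bigr => c _; rewrite sum1dep_card; apply: eq_card => x; rewrite !inE.
Qed.

Lemma slice_fib I z d j c : j \in I -> c < q ->
  slice j c (fib I z d) = fib (I :\ j) (upd z j c) d.
Proof.
move=> jI cq; apply/setP => x; rewrite inE; apply/andP/fibP.
  move=> [/fibP[dx h] /eqP xj]; split=> // i; rewrite !inE negb_and negbK.
  case: (eqVneq i j) => [->|ij] /= => [_|/h ->]; last by rewrite upd_off.
  by apply/val_inj; rewrite /= updE // eqxx.
move=> [dx h]; split; last by rewrite h ?inE ?eqxx // updE // eqxx.
apply/fibP; split=> // i iI.
by rewrite h ?inE ?(negPf iI) ?andbF // upd_off //; apply: contraNneq iI => ->.
Qed.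

(** Raising another variable stays in the slice; raising [j] comes from the slice just below, which
    is absent for [c = 0]. *)
Lemma slice_up I A j c : j \in I ->
  slice j c (up I A) =
    up (I :\ j) (slice j c A) :|: [set inc j x | x in A & ((x j).+1 < q) && ((x j).+1 == c)].
Proof.
move=> jI; apply/setP => y; apply/setIdP/setUP.
  case=> /upP[x [i [xA iI iq ->]]] /eqP.
  case: (eqVneq i j) iq iI => [->|ij] iq iI.
    rewrite incE // eqxx add1n => e; right; apply/imsetP; exists x => //.
    by rewrite !inE xA iq e eqxx.
  rewrite incE // eq_sym (negPf ij) add0n => e; left; apply/upP; exists x, i.
  by rewrite !inE ij iI xA e eqxx.
case.
  move=> /upP[x [i [/setIdP[xA /eqP e] /setD1P[ij iI] iq ->]]].
  split; last by rewrite incE // [j == i]eq_sym (negPf ij) add0n e.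
  by apply/upP; exists x, i.
case/imsetP => x; rewrite inE => /and3P[xA iq /eqP e] ->; split.
  by apply/upP; exists x, j.
by rewrite incE // eqxx add1n e.
Qed.

Lemma inc_inj_in j : {in [set x : mon l q | (x j).+1 < q] &, injective (@inc l q j)}.
Proof.
by move=> x y; rewrite !inE => hx hy e; rewrite -(dec_inc hx) e dec_inc.
Qed.

Lemma card_inc_imset j A : {in A, forall x : mon l q, (x j).+1 < q} ->
  #|[set inc j x | x in A]| = #|A|.
Proof.
by move=> h; apply: card_in_imset => x y /h hx /h hy; apply: inc_inj_in; rewrite inE.
Qed.

Definition slice_compressed j S A :=
  forall x y, x \in A -> y \in S -> y j = x j -> lexlt x y -> y \in A.

Lemma initial_compressed j S B : initial S B -> slice_compressed j S B.
Proof. by move=> [_ h] x y xB yS _; apply: h. Qed.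

(** Each [x] is tested inside its own slice, so all slices in direction [j] are replaced at once. *)
Definition compress j S A : {set mon l q} :=
  [set x in S | #|[set y in slice j (x j) S | lexlt x y]| < #|slice j (x j) A| ].

Lemma slice_compress j S A c : slice j c (compress j S A) = firstlex (slice j c S) #|slice j c A|.
Proof.
apply/setP => x; rewrite !inE -!andbA; case: (eqVneq (x j : nat) c) => [->|]; last first.
  by rewrite /= !andbF.
by rewrite /= andbT.
Qed.

Lemma slice_subset j c A B : A \subset B -> slice j c A \subset slice j c B.
Proof. by move=> /subsetP h; apply/subsetP => x; rewrite !inE => /andP[/h -> ->]. Qed.

Lemma card_slice_compress j S A c : A \subset S ->
  #|slice j c (compress j S A)| = #|slice j c A|.
Proof.
by move=> AS; rewrite slice_compress card_firstlex // subset_leq_card // slice_subset.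
Qed.

Lemma card_compress j S A : A \subset S -> #|compress j S A| = #|A|.
Proof.
move=> AS; rewrite (card_slices j) [RHS](card_slices j).
by apply: eq_bigr => c _; rewrite card_slice_compress.
Qed.

Lemma compress_sub j S A : compress j S A \subset S.
Proof. by apply/subsetP => x; rewrite inE => /andP[]. Qed.

Lemma compress_compressed j S A : slice_compressed j S (compress j S A).
Proof.
move=> x y xC yS e xy.
have : x \in slice j (x j) (compress j S A) by rewrite inE xC eqxx.
rewrite slice_compress => xF.
have [_ /(_ x y xF)] := firstlex_initial (slice j (x j) S) #|slice j (x j) A|.
rewrite inE yS e eqxx => /(_ isT xy).
by rewrite -slice_compress inE => /andP[].
Qed.

(** The Clements-Lindstrom property for the variables in [I]. Quantifying over [z] lets it be
    applied to every slice of a larger fibre. *)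
Definition up_minimal I := forall z d A B, A \subset fib I z d -> initial (fib I z d) B ->
  #|B| <= #|A| -> #|up I B| <= #|up I A|.

(** By [slice_up] each slice of the upper shadow is a union of two parts. Compression does not
    enlarge the first, by the hypothesis on [I :\ j], and keeps the size of the second. *)
Lemma up_compress I z d j A : j \in I -> up_minimal (I :\ j) -> A \subset fib I z d ->
  #|up I (compress j (fib I z d) A)| <= #|up I A|.
Proof.
move=> jI IH AF; set F := fib I z d in AF *; set A' := compress j F A.
have A'F : A' \subset F by apply: compress_sub.
rewrite (card_slices j) [X in _ <= X](card_slices j).
apply: leq_sum => c _; rewrite !slice_up //.
set L' := up _ _; set L := up _ (slice j c A).
set R' := [set _ | _ in A' & _]; set R := [set _ | _ in A & _].
have eF : slice j c F = fib (I :\ j) (upd z j c) d by rewrite slice_fib.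
have eF' : slice j c (fib I z d.+1) = fib (I :\ j) (upd z j c) d.+1 by rewrite slice_fib.
have iA' : initial (slice j c F) (slice j c A') by rewrite slice_compress; apply: firstlex_initial.
have L'L : #|L'| <= #|L|.
  rewrite eF in iA'; apply: (IH _ _ _ _ _ iA'); last by rewrite card_slice_compress.
  by rewrite -eF slice_subset.
have cR (X : {set mon l q}) : #|[set inc j x | x in X & ((x j).+1 < q) && ((x j).+1 == c)]|
    = if c == 0 :> nat then 0 else #|slice j c.-1 X|.
  rewrite card_inc_imset; last by move=> x; rewrite inE => /and3P[].
  case: c {eF eF' iA' L' L L'L R R'} => -[|c] cq /=.
    by apply/eqP; rewrite cards_eq0; apply/eqP/setP => x; rewrite !inE !andbF.
  apply: eq_card => x; rewrite !inE eqSS; case: eqP => [->|_]; last by rewrite !andbF.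
  by rewrite cq.
have R'R : #|R'| = #|R| by rewrite !cR card_slice_compress.
have iL' : initial (slice j c (fib I z d.+1)) L' by rewrite eF'; apply: up_initial; rewrite -eF.
have iR' : initial (slice j c (fib I z d.+1)) R'.
  split.
    apply/subsetP => y /imsetP[x]; rewrite inE => /and3P[xA iq /eqP e] ->.
    by rewrite inE fib_inc // (subsetP A'F) // incE // eqxx add1n e /=.
  move=> y w /imsetP[x]; rewrite inE => /and3P[xA iq /eqP e] ->.
  rewrite inE => /andP[wF /eqP wc] lt.
  have w0 : 0 < w j by rewrite wc -e.
  apply/imsetP; exists (dec j w); last by rewrite inc_dec.
  (* Dividing [w] by its variable [j] lands in the slice of [x], above [x], so compressedness of
     [A'] applies. *)
  have ed : dec j w j = x j :> nat by rewrite decE eqxx wc; lia.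
  rewrite inE ed iq e eqxx !andbT.
  apply: (@compress_compressed j F A x) => //; first by rewrite fib_dec.
    exact/val_inj.
  case/lexltP: lt => p ep lp; apply/lexltP; exists p.
    move=> i ip; case: (eqVneq i j) => [->|ij]; first exact/esym/val_inj.
    by rewrite upd_off // -ep // upd_off.
  by rewrite decE; move: lp; rewrite incE //; case: eqP => [->|_]; lia.
(* Initial segments are nested, so the union is as small as its larger part. *)
case/orP: (initial_nested iL' iR') => s.
  by rewrite (setUidPr s) R'R subset_leq_card // subsetUr.
by rewrite (setUidPl s) (leq_trans L'L) // subset_leq_card // subsetUl.
Qed.
End Fibre.

(** * The Clements-Lindstrom theorem *)

Section Macaulay.
Variables l q : nat.
Implicit Types (x y z u w : mon l q) (v c d : nat) (i j k : 'I_l).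
Implicit Types (I J : {set 'I_l}) (S A B C T : {set mon l q}).

(* Compression strictly lowers [weight], so a set of minimal [weight] is compressed in every
   direction. *)
Definition rank x := #|[set y | lexlt x y]|.
Definition weight A := \sum_(x in A) rank x.

Lemma rank_lt x y : lexlt x y -> rank y < rank x.
Proof.
move=> xy; apply: proper_card; apply/properP; split.
  by apply/subsetP => w; rewrite !inE; apply: lexlt_trans.
by exists y; rewrite !inE ?lexlt_irr.
Qed.

(** As [B] is initial, every element of [B :\: A] is lexicographically greater than every element of
    [A :\: B], and these differences have the same nonzero size. *)
Lemma weight_initial_lt S A B : A \subset S -> initial S B -> #|B| = #|A| -> B != A ->
  weight B < weight A.
Proof.
move=> AS [BS iB] e nBA.
have eD : #|B :\: A| = #|A :\: B|.
  by apply/eqP; rewrite -(eqn_add2l #|B :&: A|) cardsID [in X in _ == X]setIC cardsID e.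
have D0 : 0 < #|B :\: A|.
  by rewrite card_gt0 setD_eq0; apply: contra nBA => BA; rewrite eqEcard BA e leqnn.
have lt a b : a \in A :\: B -> b \in B :\: A -> rank b < rank a.
  rewrite !inE => /andP[aB aA] /andP[bA bB]; apply: rank_lt.
  case/or3P: (lexlt_total a b) => [/eqP h|//|h]; first by rewrite -h aA in bA.
  by rewrite (iB _ _ bB (subsetP AS _ aA) h) in aB.
case/card_gt0P: (D0) => b0 b0D.
(* The largest rank in [B :\: A] separates the two sums: ranks there are at most [rank b], those in
   [A :\: B] at least [(rank b).+1]. *)
case: (@arg_maxnP _ b0 (fun b => b \in B :\: A) rank b0D) => b bD bm.
rewrite /weight (big_setID A) /= [X in _ < X](big_setID B) /= setIC ltn_add2l.
apply: (@leq_ltn_trans (\sum_(x in B :\: A) rank b)).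
  by apply: leq_sum => x xD; apply: bm.
apply: (@leq_trans (\sum_(x in A :\: B) (rank b).+1)).
  by rewrite !sum_nat_const eD ltn_mul2l ltnS leqnn -eD D0.
by apply: leq_sum => x xD; apply: lt.
Qed.

Lemma weight_initial S A B : A \subset S -> initial S B -> #|B| = #|A| ->
  weight B <= weight A ?= iff (B == A).
Proof.
move=> AS iB e; have [->|nBA] := eqVneq B A; first by split; rewrite ?leqnn ?eqxx.
by have lt := weight_initial_lt AS iB e nBA; split; [exact: ltnW|rewrite ltn_eqF].
Qed.

Lemma weight_slices j A : weight A = \sum_(c < q) weight (slice j c A).
Proof.
rewrite /weight (partition_big (fun x => x j) predT) //=.
by apply: eq_bigr => c _; apply: eq_bigl => x; rewrite !inE.
Qed.

(** No slice gains weight, so equality of the totals forces equality in each slice. *)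
Lemma weight_compress j S A : A \subset S -> weight A <= weight (compress j S A) ->
  compress j S A = A.
Proof.
move=> AS le; set A' := compress j S A in le *.
have sl c : weight (slice j c A') <= weight (slice j c A) ?= iff (slice j c A' == slice j c A).
  apply: (@weight_initial (slice j c S)); first exact: slice_subset.
    by rewrite slice_compress; apply: firstlex_initial.
  exact: card_slice_compress.
have [ge e] := leqif_sum (fun (c : 'I_q) (_ : predT c) => sl c).
rewrite -!weight_slices in ge e.
have /forall_inP h : [forall (c : 'I_q | predT c), slice j c A' == slice j c A].
  by rewrite -e eqn_leq ge.
apply/setP => x; have /eqP/setP/(_ x) := h (x j) isT.
by rewrite !inE eqxx !andbT.
Qed.

(** Minimise [weight] over the subsets of the fibre with the size of [A] and no larger upper shadow;
    this family is stable under compression. *)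
Lemma exists_compressed I z d A : (forall j, j \in I -> up_minimal q (I :\ j)) ->
  A \subset fib I z d -> exists A',
    [/\ A' \subset fib I z d, #|A'| = #|A|, #|up I A'| <= #|up I A| &
        forall j, j \in I -> slice_compressed j (fib I z d) A'].
Proof.
move=> IH AF; set F := fib I z d in AF *.
pose P (X : {set mon l q}) := [&& X \subset F, #|X| == #|A| & #|up I X| <= #|up I A|].
have PA : P A by rewrite /P AF eqxx leqnn.
case: (arg_minnP weight PA) => A' /and3P[A'F /eqP cA' uA'] min.
exists A'; split=> // j jI.
rewrite -(@weight_compress j F A') //; first exact: compress_compressed.
apply: min; rewrite /P compress_sub card_compress // cA' eqxx /=.
by apply: leq_trans uA'; apply: up_compress => //; apply: IH.
Qed.

Lemma fib_swap I z d i k x : i \in I -> k \in I -> i != k -> (x i).+1 < q -> 0 < x k ->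
  x \in fib I z d -> inc i (dec k x) \in fib I z d.
Proof.
move=> iI kI ik iq k0; have := deg_dec k0; case: d => [|d] dk xF.
  by case/fibP: xF; lia.
by rewrite fib_inc ?fib_dec // upd_off.
Qed.

(** * Sets compressed in every direction, with at least three free variables *)

Section Stable.
Variables (I : {set 'I_l}) (k : 'I_l) (z : mon l q) (d : nat).
Hypotheses (I3 : 2 < #|I|) (kI : k \in I) (kmax : forall j, j \in I -> j <= k).
Let F := fib I z d.

(** Some third variable [j] keeps its exponent, so both monomials lie in one slice of direction [j],
    and the new one is greater because [i] precedes [k]. *)
Lemma compressed_swap A x i : A \subset F -> (forall j, j \in I -> slice_compressed j F A) ->
  x \in A -> i \in I -> i < k -> (x i).+1 < q -> 0 < x k -> inc i (dec k x) \in A.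
Proof.
move=> AF cA xA iI ik iq k0; have nik := ord_lt_eqF ik.
have ed : dec k x i = x i by rewrite upd_off // nik.
have [j] : exists j, j \in I :\ k :\ i.
  apply/set0Pn; rewrite -card_gt0.
  by move: I3; rewrite (cardsD1 k I) kI (cardsD1 i (I :\ k)) !inE nik iI.
rewrite !inE => /and3P[ji jk jI]; apply: (cA j jI x) => //.
- by apply: fib_swap (subsetP AF _ xA); rewrite ?nik.
- by rewrite !upd_off.
apply/lexltP; exists i; last by rewrite incE ?ed // eqxx.
move=> p pi; rewrite !upd_off // -(inj_eq val_inj) /= ?(ltn_eqF pi) //.
by rewrite (ltn_eqF (ltn_trans pi ik)).
Qed.

(** Swaps inside [A] lower the exponent of [x] at [k] without passing [u]; once it equals [u k],
    compression in direction [k] concludes. *)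
Lemma compressed_up_lex A x u : A \subset F -> (forall j, j \in I -> slice_compressed j F A) ->
  x \in A -> u \in F -> lexle x u -> u k <= x k -> u \in A.
Proof.
move=> AF cA xA uF; have [n] := ubnP (x k - u k); elim: n x xA => // n IH x xA ltn.
case/orP => [/eqP <- //|lt le].
have xF := subsetP AF _ xA.
case: (ltngtP (u k) (x k)) le => // [uk _|/val_inj uk _]; last exact: (cA k kI x).
have [i [iI ik iq le]] := lex_swap_le kmax (fib_agree xF uF) lt
  (etrans (proj1 (fibP _ _ _ _ xF)) (esym (proj1 (fibP _ _ _ _ uF)))) uk.
have x0 : 0 < x k := leq_ltn_trans (leq0n _) uk.
have nik := ord_lt_eqF ik.
have ek : inc i (dec k x) k = (x k).-1 :> nat.
  by rewrite upd_off 1?eq_sym ?nik // decE eqxx subn1.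
apply: (IH _ (compressed_swap AF cA xA iI ik iq x0)) => //; rewrite ek; clear -x0 uk ltn; lia.
Qed.

(** When [x k] is positive, raising an earlier [i] equals swapping [k] for [i] and then raising [k].
    So only the slice at 0 contributes besides the raises of [k], and the exponent at [k] keeps the
    two parts disjoint. *)
Lemma card_up_compressed A : A \subset F -> (forall j, j \in I -> slice_compressed j F A) ->
  #|up I A| = #|up (I :\ k) (slice k 0 A)| + #|[set x in A | (x k).+1 < q]|.
Proof.
move=> AF cA.
rewrite -[X in _ + X](@card_inc_imset _ _ k); last by move=> x; rewrite inE => /andP[].
set U := up _ (slice _ _ _); set V := [set _ | _ in _].
have -> : up I A = U :|: V.
  apply/setP => y; apply/idP/setUP => [|[]].
  - case/upP => x [i [xA iI iq ->]]; have [eik|nik] := eqVneq i k.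
      by right; subst i; apply/imsetP; exists x => //; rewrite inE xA.
    have ik : i < k by rewrite ltn_neqAle kmax // andbT.
    have [x0|x0] := posnP (x k).
      by left; apply/upP; exists x, i; rewrite !inE nik iI xA x0.
    right; apply/imsetP; exists (inc i (dec k x)).
      rewrite inE compressed_swap // upd_off 1?eq_sym // decE eqxx.
      by have := ltn_ord (x k); lia.
    have kq := ltn_ord (x k); have ed : dec k x i = x i by rewrite upd_off.
    have ed' : (inc i (dec k x) k).+1 = x k :> nat.
      by rewrite upd_off 1?eq_sym // decE eqxx; lia.
    apply: monP => j; rewrite (@incE _ _ i x) // (@incE _ _ k (inc i (dec k x))) ?ed' //.
    rewrite (@incE _ _ i (dec k x)) ?ed // decE.
    by case: (eqVneq j k) => [->|]; lia.
  - case/upP => x [i [/setIdP[xA _] /setD1P[_ iI] iq ->]].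
    by apply/upP; exists x, i.
  - case/imsetP => x /setIdP[xA iq] ->.
    by apply/upP; exists x, k.
apply/eqP; rewrite eqn_leq leq_card_setU /= cardsU -[X in X <= _]subn0 leq_sub2l //.
rewrite leqn0 cards_eq0 -subset0; apply/subsetP => y /setIP[].
case/upP => x [i [/setIdP[_ /eqP x0] /setD1P[nik _] iq ->]].
case/imsetP => x' /setIdP[_ kq] /(congr1 (fun y : mon l q => y k : nat)).
by rewrite !incE // eqxx eq_sym (negPf nik) x0.
Qed.

Lemma up_minimal_compressed A B : up_minimal q (I :\ k) ->
  A \subset F -> (forall j, j \in I -> slice_compressed j F A) ->
  initial F B -> #|B| <= #|A| -> #|up I B| <= #|up I A|.
Proof.
move=> IH AF cA iB leBA; have [BF BB] := iB.
rewrite !card_up_compressed //; last by move=> j _; apply: initial_compressed.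
apply: leq_add.
- have q0 : 0 < q := leq_ltn_trans (leq0n _) (ltn_ord (z k)).
  have eF : slice k 0 F = fib (I :\ k) (upd z k 0) d by rewrite slice_fib.
  apply: (IH (upd z k 0) d); rewrite -?eF.
  + exact: slice_subset.
  + split; first exact: slice_subset.
    move=> x y /setIdP[xB _] /setIdP[yF y0] lt.
    by rewrite inE y0 (BB x).
  (* A monomial [u] of [B] outside [A] with exponent 0 at [k] would have all of [A] strictly above
     it, by [compressed_up_lex]; then [A] lies in [B :\ u] and is too small. *)
  rewrite leqNgt; apply/negP => lt.
  have /subsetPn[u] : ~~ (slice k 0 B \subset slice k 0 A).
    by apply: contraL lt => /subset_leq_card; rewrite leqNgt.
  move=> /setIdP[uB /eqP u0]; rewrite inE u0 eqxx andbT => uA.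
  have AB : A \subset B :\ u.
    apply/subsetP => x xA; rewrite !inE.
    have nxu : x != u by apply: contraNneq uA => <-.
    rewrite nxu (BB u) ?(subsetP AF) // lexltNge; apply: contra uA => le.
    by apply: compressed_up_lex le _ => //; rewrite ?(subsetP BF) // u0.
  by have := subset_leq_card AB; rewrite leqNgt (leq_trans _ leBA) // [X in _ < X](cardsD1 u) uB.
(* For the second term, compare the monomials with exponent q - 1 at [k]. If one of [A] is missing
   from [B], all of [B] lies above it, and maximality of its exponent at [k] puts [B] inside [A]. *)
pose top (X : {set mon l q}) := [set x in X | (x k).+1 >= q].
have split (X : {set mon l q}) : #|X| = #|[set x in X | (x k).+1 < q]| + #|top X|.
  rewrite -(cardsID [set x : mon l q | (x k).+1 < q] X); congr (_ + _); apply: eq_card => x.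
    by rewrite !inE.
  by rewrite !inE -leqNgt andbC.
have [BA|/subsetPn[u]] := boolP (top A \subset top B).
  by have := subset_leq_card BA; have := split A; have := split B; lia.
rewrite inE => /andP[uA uq]; rewrite inE uq andbT => uB.
have BA : B \subset A.
  apply/subsetP => w wB; apply: (@compressed_up_lex A u) => //; first exact: (subsetP BF).
    apply/orP; right; rewrite lexltNge; apply: contra uB => /orP[/eqP <- //|].
    exact/BB/(subsetP AF).
  by rewrite -ltnS (leq_trans (ltn_ord _) uq).
by apply/subset_leq_card/subsetP => x /setIdP[/(subsetP BA) xA xq]; rewrite inE xA.
Qed.

End Stable.
Lemma fib_le1 I z d x y : #|I| <= 1 -> x \in fib I z d -> y \in fib I z d -> x = y.
Proof.
move=> I1 xF yF; have ag := fib_agree xF yF.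
case/fibP: xF => dx _; case/fibP: yF => dy _.
have [/set0Pn[i iI]|/negbNE/eqP I0] := boolP (I != set0); last first.
  by apply/ffunP => j; apply: ag; rewrite I0 inE.
have off j : j != i -> x j = y j.
  move=> ji; apply: ag; apply: contra ji => jI; apply/eqP.
  exact: (card_le1_eqP I1).
have [le|/ltnW le] := leqP (x i) (y i).
  by apply: deg_dom; rewrite ?dx ?dy // => j; case: (eqVneq j i) => [-> //|/off ->].
by apply/esym/deg_dom; rewrite ?dx ?dy // => j; case: (eqVneq j i) => [-> //|/off ->].
Qed.

Lemma exists_min_coord i A : A != set0 ->
  exists2 a : mon l q, a \in A & forall x : mon l q, x \in A -> a i <= x i.
Proof.
move=> /set0Pn[a0 a0A].
by case: (@arg_minnP _ a0 (fun a => a \in A) (fun a => a i : nat) a0A) => a; exists a.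
Qed.

(** * Two free variables: the fibre is a chain indexed by the exponent at [i] *)

Section Pair.
Variables (i k : 'I_l) (z : mon l q) (d : nat).
Hypothesis (ik : i < k).
Let I := [set i; k].
Let F := fib I z d.

Let iI : i \in I. Proof. by rewrite !inE eqxx. Qed.
Let kI : k \in I. Proof. by rewrite !inE eqxx orbT. Qed.
Let nik : (i == k) = false. Proof. exact: ord_lt_eqF. Qed.
Let nki : (k == i) = false. Proof. by rewrite eq_sym. Qed.

Lemma pair_sum x y : x \in F -> y \in F -> x i + x k = y i + y k.
Proof.
move=> xF yF; have ag := fib_agree xF yF.
case/fibP: xF => dx _; case/fibP: yF => dy _; move: dx; rewrite -dy /deg.
rewrite (bigD1 i) // (bigD1 k) /= ?nki //.
rewrite [in X in _ = X -> _](bigD1 i) // [in X in _ = X -> _](bigD1 k) /= ?nki //.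
rewrite [in X in X = _ -> _](eq_bigr (fun j => y j : nat)); first lia.
by move=> j /andP[ji jk]; rewrite ag // !inE negb_or ji.
Qed.

Lemma pair_eq x y : x \in F -> y \in F -> x i = y i :> nat -> x = y.
Proof.
move=> xF yF e; have s := pair_sum xF yF; apply: monP => j.
have [->//|ji] := eqVneq j i; have [->|jk] := eqVneq j k; first lia.
by rewrite (fib_agree xF yF) // !inE negb_or ji.
Qed.

Lemma pair_lt x y : x \in F -> y \in F -> x i < y i -> lexlt x y.
Proof.
move=> xF yF lt; apply/lexltP; exists i => // j ji.
by apply: (fib_agree xF yF); rewrite !inE (ord_lt_eqF ji) (ord_lt_eqF (ltn_trans ji ik)).
Qed.

Lemma pair_up_ge A : A \proper F -> #|A| <= #|up I A|.
Proof.
move=> /properP[AF [g gF gA]].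
(* The gap [g] keeps the images of elements on either side of it apart. *)
pose f x := if x i < g i then inc i x else inc k x.
(* The exponents of [g] bound those of [x] strictly, at [i] on one side of the gap and at [k] on the
   other, so the chosen raise is allowed. *)
have cap x : x \in A -> if x i < g i then (x i).+1 < q else (g i < x i) && ((x k).+1 < q).
  move=> xA; have xF := subsetP AF _ xA; have e := pair_sum xF gF.
  case: ltngtP => [lt|lt|/(pair_eq xF gF) exg]; last by rewrite -exg xA in gA.
    exact: leq_ltn_trans (ltn_ord (g i)).
  rewrite /=; apply: leq_ltn_trans (ltn_ord (g k)).
  by rewrite -(ltn_add2l (x i)) e ltn_add2r.
have finj (x y : mon l q) : x \in A -> y \in A -> f x = f y -> x = y.
  move=> xA yA; move: (cap x xA) (cap y yA); rewrite /f.
  case: (ltnP (x i)) => xg; case: (ltnP (y i)) => yg.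
  - by move=> hx hy; apply: inc_inj_in; rewrite inE.
  - move=> hx /andP[hy1 hy2] /(congr1 (fun w : mon l q => w i : nat)).
    by rewrite !incE // eqxx nik => e; exfalso; clear -xg hy1 e; lia.
  - move=> /andP[hx1 hx2] hy /(congr1 (fun w : mon l q => w i : nat)).
    by rewrite !incE // eqxx nik => e; exfalso; clear -yg hx1 e; lia.
  - by move=> /andP[_ hx] /andP[_ hy]; apply: inc_inj_in; rewrite inE.
rewrite -(@card_in_imset _ _ f A); last by move=> x y; apply: finj.
apply/subset_leq_card/subsetP => y /imsetP[x xA ->]; apply/upP.
move: (cap x xA); rewrite /f; case: ifP => _ => [iq|/andP[_ kq]].
  by exists x, i.
by exists x, k.
Qed.

(** Raising [i] is injective, and raising [k] at an element of least exponent at [i] gives one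
    further monomial. *)
Lemma pair_up_gt A : A != set0 -> {in A, forall x : mon l q, (x i).+1 < q /\ (x k).+1 < q} ->
  #|A| < #|up I A|.
Proof.
move=> A0 h; have [a aA am] := exists_min_coord i A0.
rewrite -(@card_inc_imset _ _ i A); last by move=> x /h[].
apply: proper_card; apply/properP; split.
  by apply/subsetP => y /imsetP[x xA ->]; apply/upP; exists x, i; case: (h x xA).
have [ai ak] := h a aA.
exists (inc k a); first by apply/upP; exists a, k.
have inc_neq (x : mon l q) : x \in A -> inc k a <> inc i x.
  move=> xA /(congr1 (fun w : mon l q => w i : nat)).
  have [xi xk] := h x xA; have le := am x xA.
  by rewrite !incE // eqxx nik => e; clear -le e; lia.
by apply/imsetP => -[x xA]; apply: inc_neq.
Qed.

(** Raising [k] at [x] equals raising [i] at the next smaller element of the chain, which is still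
    in [B] unless [x] is its last element [b]. Hence the single extra term. *)
Lemma pair_up_initial B : initial F B -> #|up I B| <= #|[set x in B | (x i).+1 < q]|.+1.
Proof.
move=> [BF iB]; have [->|B0] := eqVneq B set0.
  by rewrite up0 cards0.
have [b bB bm] := exists_min_coord i B0.
set C := [set x in B | _].
rewrite -(@card_inc_imset _ _ i C); last by move=> x /setIdP[].
apply: (@leq_trans #|inc k b |: [set inc i x | x in C]|); last first.
  by rewrite cardsU1; case: (_ \notin _).
apply/subset_leq_card/subsetP => y /upP[x [j [xB jI jq ->]]].
apply/setU1P; have [eji|nji] := eqVneq j i.
  by right; subst j; apply/imsetP; exists x => //; rewrite inE xB.
have ejk : j = k by apply/eqP; move: jI; rewrite !inE (negPf nji).
subst j; have xF := subsetP BF _ xB; have bF := subsetP BF _ bB.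
have [e|nxb] := eqVneq (x i : nat) (b i); first by left; rewrite (pair_eq xF bF e).
have bx : b i < x i by rewrite ltn_neqAle eq_sym nxb bm.
have x0 : 0 < x i by apply: leq_ltn_trans bx.
have xq := ltn_ord (x i).
have ei : inc k (dec i x) i = (x i).-1 :> nat by rewrite upd_off ?nik // decE eqxx subn1.
have ek : dec i x k = x k by rewrite upd_off ?nki.
have x'F : inc k (dec i x) \in F by apply: fib_swap; rewrite ?nki.
right; apply/imsetP; exists (inc k (dec i x)).
  rewrite inE ei prednK // xq andbT.
  have [e|ne] := eqVneq (inc k (dec i x) i : nat) (b i); first by rewrite (pair_eq x'F bF e).
  by apply: (iB b) => //; apply: pair_lt => //; rewrite ltn_neqAle eq_sym ne ei -ltnS prednK.
apply: monP => j; rewrite (@incE _ _ k x) // (@incE _ _ i (inc k (dec i x))) ?ei ?prednK //.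
rewrite (@incE _ _ k (dec i x)) ?ek // decE; case: (eqVneq j i) => [->|_].
  by rewrite nik !add0n add1n subn1 prednK.
by rewrite subn0 add0n.
Qed.

Lemma up_minimal_pair A B : A \subset F -> initial F B -> #|B| <= #|A| ->
  #|up I B| <= #|up I A|.
Proof.
move=> AF iB leBA; have [BF BB] := iB.
have [eAF|nAF] := boolP (F \subset A).
  by apply/subset_leq_card/up_mono/(subset_trans BF).
have pA : A \proper F by rewrite properE AF.
have [B0|/set0Pn[b bB]] := eqVneq B set0.
  by apply/subset_leq_card/up_mono; rewrite B0 sub0set.
have A0 : A != set0 by rewrite -card_gt0 (leq_trans _ leBA) // card_gt0; apply/set0Pn; exists b.
apply: (leq_trans (pair_up_initial iB)).
have bF := subsetP BF _ bB.
(* A [t] with exponent q - 1 at [i] heads the chain, so it lies in [B]; as it cannot be raised at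
   [i], it absorbs the extra 1 of [pair_up_initial]. *)
have [/existsP[t /andP[tF tq]]|no] := boolP [exists t, (t \in F) && (q <= (t i).+1)].
  have tB : t \in B.
    have [e|ne] := eqVneq (b i : nat) (t i); first by rewrite -(pair_eq bF tF e).
    apply: (BB b) => //; apply: pair_lt => //.
    by rewrite ltn_neqAle ne -ltnS (leq_trans (ltn_ord _) tq).
  apply: leq_trans (pair_up_ge pA); apply: leq_trans leBA.
  apply: proper_card; apply/properP; split; first by apply/subsetP => x /setIdP[].
  by exists t => //; rewrite inE tB ltnNge tq.
have capi x : x \in F -> (x i).+1 < q.
  by move=> xF; move/existsPn/(_ x): no; rewrite xF /= -ltnNge.
have capk (x : mon l q) : x \in F -> (x k).+1 < q.
  move=> xF; rewrite ltnNge; apply/negP => xk.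
  have xkq := ltn_ord (x k); have xiq := ltn_ord (x i).
  (* Exchanging the two exponents preserves the fibre and transfers the bound at [i] to [k]. *)
  pose t := upd (upd x i (x k)) k (x i).
  have ti : t i = x k :> nat by rewrite upd_off ?nik // updE // eqxx.
  suff /capi : t \in F by rewrite ti ltnNge xk.
  case/fibP: (xF) => dx ax; apply/fibP; split.
    have := @deg_upd _ _ x i _ xkq; have := @deg_upd _ _ (upd x i (x k)) k _ xiq.
    by rewrite upd_off ?nki // -/t => e1 e2; clear -dx e1 e2; lia.
  move=> j jI; move: (jI); rewrite !inE negb_or => /andP[ji jk].
  by rewrite !upd_off // ax.
apply: (@leq_trans #|B|.+1); first by rewrite ltnS; apply/subset_leq_card/subsetP => x /setIdP[].
apply: (leq_ltn_trans leBA); apply: pair_up_gt => // x /(subsetP AF) xF.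
by split; [apply: capi|apply: capk].
Qed.

End Pair.

(* The Clements-Lindstrom theorem with all exponent bounds equal to [q - 1]. *)
Theorem up_minimal_all I : up_minimal q I.
Proof.
have [n] := ubnP #|I|; elim: n I => // n IHn I; rewrite ltnS => In z d A B AF iB leBA.
have IH j : j \in I -> up_minimal q (I :\ j).
  by move=> jI; apply: IHn; move: In; rewrite (cardsD1 j I) jI.
case: (ltngtP #|I| 2) => [I1|I3|/eqP/cards2P[i [k [nik eI]]]].
(* With at most one free variable the fibre has at most one element, so [B] lies in [A]. *)
- apply/subset_leq_card/up_mono/subsetP => x xB.
  have /card_gt0P[a aA] : 0 < #|A| by apply: leq_trans leBA; apply/card_gt0P; exists x.
  by rewrite (fib_le1 I1 (subsetP iB.1 _ xB) (subsetP AF _ aA)).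
- have /card_gt0P[k0 k0I] : 0 < #|I| by apply: leq_trans I3.
  case: (@arg_maxnP _ k0 (fun k => k \in I) (fun k => k : nat) k0I) => k kI kmax.
  have [A' [A'F cA' uA' compA']] := exists_compressed IH AF.
  apply: leq_trans uA'.
  by apply: (@up_minimal_compressed I k z d) => //; [apply: IH|rewrite cA'].
rewrite {I In IH}eI in AF iB *.
case: (ltngtP i k) => [ik|ki|/val_inj eik]; last by rewrite eik eqxx in nik.
  exact: (@up_minimal_pair i k z d).
rewrite setUC in AF iB *.
exact: (@up_minimal_pair k i z d).
Qed.
End Macaulay.

(** * Shadows in all degrees *)

Section Shadow.
Variables l q : nat.
Implicit Types (x y z u w : mon l q) (v c d e : nat) (i j k : 'I_l).
Implicit Types (S A B C T R : {set mon l q}).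

Lemma mdvdP x y : reflect (forall i, x i <= y i) (mdvd x y).
Proof. exact: forallP. Qed.

Lemma shadowP T y : reflect (exists2 x, x \in T & mdvd x y) (y \in shadow T).
Proof. by rewrite inE; apply: exists_inP. Qed.

Lemma leq_deg x y : mdvd x y -> deg x <= deg y.
Proof. by move/mdvdP => h; apply: leq_sum. Qed.

Lemma mdvd_inc x y : mdvd x y -> deg x < deg y ->
  exists2 i : 'I_l, (x i).+1 < q & mdvd (inc i x) y.
Proof.
move=> /mdvdP h dlt; have [/existsP[i lt]|/existsPn no] := boolP [exists i, x i < y i].
  have iq : (x i).+1 < q by apply: leq_ltn_trans (ltn_ord (y i)).
  exists i => //; apply/mdvdP => j; rewrite incE //.
  by case: (eqVneq j i) => [->|_]; rewrite ?add0n.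
suff e : x = y by rewrite e ltnn in dlt.
by apply: monP => i; apply/eqP; rewrite eqn_leq h leqNgt no.
Qed.

Definition inc_closed R := forall x i, x \in R -> (x i).+1 < q -> inc i x \in R.

(** Raise [x] one unit at a time towards [y] and stop at degree [e]; the last clause carries
    membership along this path. *)
Lemma mdvd_between x y e : mdvd x y -> deg x <= e -> e <= deg y ->
  exists w, [/\ deg w = e, mdvd x w, mdvd w y & forall R, inc_closed R -> x \in R -> w \in R].
Proof.
move=> xy; have [n] := ubnP (e - deg x); elim: n x xy => // n IH x xy ltn xe ey.
have [dx|dx] := eqVneq (deg x) e.
  by exists x; split=> //; apply/mdvdP.
have xlt : deg x < e by rewrite ltn_neqAle dx.
have [i iq dv] := mdvd_inc xy (leq_trans xlt ey).
have di := deg_inc iq.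
have [|||w [dw h1 h2 h3]] := IH (inc i x) dv; rewrite ?di //; first lia.
exists w; split=> //; last by move=> R cR xR; apply: h3 => //; apply: cR.
apply/mdvdP => j; apply: leq_trans (mdvdP _ _ h1 j).
by rewrite incE // leq_addl.
Qed.

Lemma inc_closed_mdvd R x y : inc_closed R -> x \in R -> mdvd x y -> y \in R.
Proof.
move=> cR xR xy; have [w [dw _ /mdvdP wy h]] := mdvd_between xy (leq_deg xy) (leqnn _).
by rewrite -(deg_dom wy _) ?dw //; apply: h.
Qed.

(** [fib] needs a reference monomial even when nothing is frozen; an element of [B] serves, and an
    empty [B] is trivial. *)
Lemma up_minimal_Heq d A B : A \subset Heq l q d -> initial (Heq l q d) B -> #|B| <= #|A| ->
  #|up setT B| <= #|up setT A|.
Proof.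
move=> AH iB le; have [->|/set0Pn[z zB]] := eqVneq B set0.
  by apply/subset_leq_card/up_mono/sub0set.
by apply: (@up_minimal_all l q setT z d); rewrite ?fibT.
Qed.

Lemma up_initial_Heq d B : initial (Heq l q d) B -> initial (Heq l q d.+1) (up setT B).
Proof.
move=> iB; have [->|/set0Pn[z zB]] := eqVneq B set0.
  by rewrite up0; split=> [|x y]; [apply: sub0set|rewrite inE].
by rewrite -(fibT z); apply: up_initial; rewrite fibT.
Qed.

Definition lexify S : {set mon l q} :=
  [set x | x \in firstlex (Heq l q (deg x)) #|S :&: Heq l q (deg x)| ].

Lemma lexify_Heq S d : lexify S :&: Heq l q d = firstlex (Heq l q d) #|S :&: Heq l q d|.
Proof.
apply/setP => x; apply/setIP/idP.
  by rewrite inE => -[h]; rewrite inE => /eqP e; rewrite e in h.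
move=> h; have := subsetP (firstlex_initial _ _).1 _ h; rewrite inE => /eqP e.
by split; rewrite ?[_ \in lexify S]inE ?[_ \in Heq _ _ _]inE e.
Qed.

Lemma card_lexify_Heq S d : #|lexify S :&: Heq l q d| = #|S :&: Heq l q d|.
Proof. by rewrite lexify_Heq card_firstlex // subset_leq_card // subsetIr. Qed.

Lemma lexify_initial S d : initial (Heq l q d) (lexify S :&: Heq l q d).
Proof. by rewrite lexify_Heq; apply: firstlex_initial. Qed.

(** The upper shadow of the degree [d] segment is itself a segment, of size at most that of the
    upper shadow of [S] in degree [d], which lies in [S]. Segments of one degree are compared by
    size. *)
Lemma lexify_inc_closed S : inc_closed S -> inc_closed (lexify S).
Proof.
move=> cS x i xR iq; set d := deg x.
have xRd : x \in lexify S :&: Heq l q d by rewrite in_setI xR inE eqxx.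
suff /subsetP h : up setT (lexify S :&: Heq l q d) \subset lexify S :&: Heq l q d.+1.
  have /h/setIP[] // : inc i x \in up setT (lexify S :&: Heq l q d).
  by apply/upP; exists x, i; rewrite in_setT.
apply: (initial_sub (up_initial_Heq (lexify_initial S d)) (lexify_initial S d.+1)).
apply: leq_trans (up_minimal_Heq (subsetIr S _) (lexify_initial S d) _) _.
  by rewrite card_lexify_Heq.
rewrite card_lexify_Heq; apply/subset_leq_card/subsetP => y /upP[w [j [/setIP[wS wd] _ jq ->]]].
rewrite inE cS //; rewrite !inE in wd *.
by rewrite deg_inc // eqSS.
Qed.

(** [lex_inc_le] raises [x] degree by degree without passing [u]; in equal degree the segment
    property concludes. *)
Lemma lexify_up S x u : inc_closed S -> x \in lexify S -> lexle x u -> deg x <= deg u ->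
  u \in lexify S.
Proof.
move=> cS; have [n] := ubnP (deg u - deg x); elim: n x => // n IH x ltn xR.
case/orP => [/eqP <- //|lt]; rewrite leq_eqVlt => /orP[/eqP e|dlt].
  have [_ /(_ x u)] := lexify_initial S (deg u).
  by rewrite !in_setI xR ![_ \in Heq _ _ _]inE e eqxx lt => /(_ isT isT isT)/andP[].
have [i iq le] := lex_inc_le lt dlt.
have di := deg_inc iq.
by apply: (IH (inc i x)) le _; rewrite ?di //; [lia|apply: lexify_inc_closed].
Qed.

Lemma card_Hle_split A e : #|A :&: Hle l q e| = \sum_(d < e.+1) #|A :&: Heq l q d|.
Proof.
rewrite -sum1_card (partition_big (fun x => inord (deg x) : 'I_e.+1) predT) //=.
apply: eq_bigr => c _; rewrite sum1dep_card; apply: eq_card => x.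
rewrite !inE -andbA; congr (_ && _).
apply/andP/eqP => [[h /eqP <-]|h]; first by rewrite inordK.
have cl := ltn_ord c; rewrite h -ltnS cl; split=> //.
by apply/eqP/val_inj; rewrite /= inordK.
Qed.

Lemma shadow_inc_closed T : inc_closed (shadow T).
Proof.
move=> x i /shadowP[t tT /mdvdP tx] iq; apply/shadowP; exists t => //.
by apply/mdvdP => j; rewrite incE // (leq_trans (tx j)) // leq_addl.
Qed.

Lemma sub_shadow T : T \subset shadow T.
Proof. by apply/subsetP => x xT; apply/shadowP; exists x => //; apply/mdvdP. Qed.

Lemma Mset_mdvd e r x y : x \in Mset l q e r -> mdvd x y -> deg y <= e -> y \in Mset l q e r.
Proof.
move=> xM /mdvdP xy ye; case/orP: (lexle_dom xy) => [/eqP <- //|lt].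
by apply: (firstlex_initial _ _).2 xM _ lt; rewrite inE.
Qed.

Lemma card_firstlex_le S r : #|firstlex S r| <= r.
Proof.
have [le|/ltnW le] := leqP r #|S|; first by rewrite card_firstlex.
by apply: leq_trans le; apply/subset_leq_card; case: (firstlex_initial S r).
Qed.

Lemma Mset_sub_lexify S e r x : inc_closed S -> r <= #|S :&: Hle l q e| ->
  x \in Mset l q e r -> deg x = e -> x \in lexify S.
Proof.
move=> cS le xM dx; apply: contraTT le => xR; rewrite -ltnNge.
have -> : #|S :&: Hle l q e| = #|lexify S :&: Hle l q e|.
  by rewrite !card_Hle_split; apply: eq_bigr => d _; rewrite card_lexify_Heq.
move: xM; rewrite inE => /andP[_]; apply: leq_ltn_trans.
apply/subset_leq_card/subsetP => y /setIP[yR ye]; rewrite !inE in ye *.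
rewrite ye lexltNge; apply: contra xR => le.
by apply: lexify_up le _ => //; rewrite dx.
Qed.

Lemma shadow_lexify_bound T e : T \subset Hle l q e.+1 ->
  #|shadow (Lset l q e.+1 #|T :&: Heq l q e.+1| :|: Mset l q e (#|T| - #|T :&: Heq l q e.+1|))|
    <= #|shadow T|.
Proof.
move=> TH; set s := #|T| - _; set L := Lset _ _ _ _; set M := Mset _ _ _ _.
set S := shadow T; set V := shadow _; pose R := lexify S.
have cS : inc_closed S by apply: shadow_inc_closed.
have cR : inc_closed R by apply: lexify_inc_closed.
have cardHle d A : #|A| = #|A :&: Hle l q d| + #|A :\: Hle l q d| by rewrite cardsID.
have sE : s <= #|S :&: Hle l q e|.
  have -> : s = #|T :&: Hle l q e|.
    rewrite /s -(cardsID (Hle l q e) T) (_ : T :\: _ = T :&: Heq l q e.+1) ?addnK //.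
    apply/setP => x; rewrite !inE; case: (boolP (x \in T)) => [/(subsetP TH)|]; rewrite ?andbF //.
    by rewrite inE andbT; lia.
  by apply/subset_leq_card/setSI/sub_shadow.
have LR : L \subset R.
  apply/subsetP => x xL; have := subsetP (firstlex_initial _ _).1 _ xL; rewrite inE => /eqP dx.
  rewrite inE dx; move: xL; rewrite !inE => /andP[-> h]; apply: leq_trans h _.
  by apply/subset_leq_card/setSI/sub_shadow.
have SR : #|S| = #|R|.
  (* Every degree is at most [l * q], so summing over these degrees counts the whole set. *)
  have full A : A = A :&: Hle l q (l * q).
    apply/setP => x; rewrite !inE (_ : _ <= _) ?andbT // /deg.
    rewrite -[l in X in _ <= X]card_ord -sum_nat_const; apply: leq_sum => i _.
    exact/ltnW/ltn_ord.
  rewrite (full S) (full R) !card_Hle_split; apply: eq_bigr => d _; by rewrite card_lexify_Heq.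
have SRe : #|S :&: Hle l q e| = #|R :&: Hle l q e|.
  by rewrite !card_Hle_split; apply: eq_bigr => d _; rewrite card_lexify_Heq.
(* Up to degree [e] only [M] contributes to the shadow, and it is closed under multiples there;
   above [e] the shadow lies in [R]. *)
rewrite SR (cardHle e V) (cardHle e R); apply: leq_add.
- rewrite -SRe (leq_trans _ sE) // (leq_trans _ (card_firstlex_le (Hle l q e) s)) //.
  apply/subset_leq_card/subsetP => y /setIP[/shadowP[x xU xy]].
  rewrite inE => ye; case/setUP: xU => [xL|xM]; last exact: (Mset_mdvd xM xy ye).
  have := subsetP (firstlex_initial _ _).1 _ xL; rewrite inE => /eqP dx.
  by have := leq_deg xy; lia.
apply/subset_leq_card/subsetP => y /setDP[/shadowP[x xU xy]].
rewrite inE -ltnNge => ye; apply/setDP; split; last by rewrite inE -ltnNge.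
case/setUP: xU => [/(subsetP LR) xR|xM]; first exact: inc_closed_mdvd xy.
have := subsetP (firstlex_initial _ _).1 _ xM; rewrite inE => dx.
(* The path from [x] to [y] is cut at degree exactly [e], where [w] is still in [M] and therefore in
   [R]. *)
have [w [dw xw wy _]] := mdvd_between xy dx (ltnW ye).
apply: inc_closed_mdvd wy => //; apply: (@Mset_sub_lexify S e s) => //.
by apply: Mset_mdvd xw _; rewrite ?dw.
Qed.
End Shadow.

Theorem theorem3p7 (q m l d rho : nat)
  (hq : prime_power q) (hm : 0 < m)
  (hl : 0 < l) (hlm : l <= m) (hd : 0 < d) (hdl : d <= l * (q - 1))
  (hrho : 0 < rho) (hrhoH : rho <= #|Hle l q d|)
  (T : {set mon l q}) (hT : T \subset Hle l q d) (hTcard : #|T| = rho) :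
  let rho' := #|T :&: Heq l q d| in
  #|footprint T| <= #|footprint (Lset l q d rho' :|: Mset l q (d - 1) (rho - rho'))|.
Proof.
rewrite /= -hTcard; case: d hd hT {hdl hrhoH} => // e _ hT; rewrite subn1 /=.
(* Footprints are complements of shadows, so the inequality reverses into one between shadows. *)
set U := _ :|: _; rewrite /footprint -(leq_add2l #|shadow T|) cardsC.
by rewrite -(cardsC (shadow U)) leq_add2r; apply: shadow_lexify_bound.
Qed.
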